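(* Let $d \geq 2$ be an integer, and let $q \equiv 1 \pmod {d}$ be an odd power of a prime $p$. Let $H=(\mathbb{F}_q^* )^d$, let $g$ be a primitive root of $\mathbb{F}_q$ (a generator of $\mathbb{F}_q^*$), and let $I \subseteq \mathbb{Z}/d\mathbb{Z}$ be an index set. Consider the graph $X=\operatorname{Cay}(\mathbb{F}_q^+; S_{d,I})$, where $S_{d, I}=\bigcup_{i \in I} g^i H$ satisfies $S_{d,I}=-S_{d,I}$. If $I-I \neq \mathbb{Z}/d\mathbb{Z}$, then $$\omega(X) \leq \sqrt{\frac{|I-I|\,q}{d}}+\sqrt{\frac{q}{p}}.$$ In particular, if additionally $q\equiv 1 \pmod {2d}$ in the case that $q$ is odd, then $\omega(GP(q,d))\leq \sqrt{q/d}+\sqrt{q/p}$.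
   Context: $\mathbb{F}_q$ is the finite field with $q$ elements, $\mathbb{F}_q^+$ its additive group, and $\mathbb{F}_q^*=\mathbb{F}_q\setminus\{0\}$. An odd power of $p$ means $p^{2r+1}$ with $r\ge 0$ an integer. $(\mathbb{F}_q^* )^d=\{x^d: x\in\mathbb{F}_q^*\}$; since this subgroup has index $d$ in $\mathbb{F}_q^*$, the coset $g^iH$ is well defined for $i\in\mathbb{Z}/d\mathbb{Z}$. $I-I=\{i-j: i,j\in I\}\subseteq \mathbb{Z}/d\mathbb{Z}$. For $S\subseteq\mathbb{F}_q^*$ with $S=-S$ (where $-S=\{-s:s\in S\}$), the Cayley graph $\operatorname{Cay}(\mathbb{F}_q^+;S)$ is the graph with vertex set $\mathbb{F}_q$ in which two vertices are adjacent if and only if their difference lies in $S$. For $d>1$ and a prime power $q\equiv 1 \pmod d$, with moreover $q\equiv 1\pmod{2d}$ if $q$ is odd, the $d$-Paley graph is $GP(q,d)=\operatorname{Cay}(\mathbb{F}_q^+;(\mathbb{F}_q^* )^d)$. The clique number $\omega(X)$ of a graph $X$ is the maximum number of vertices of a complete subgraph of $X$. *)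

(* Defs.v *)
From mathcomp Require Import all_boot all_order all_algebra all_fingroup all_solvable.

Set Implicit Arguments.
Unset Strict Implicit.
Unset Printing Implicit Defensive.

Import GRing.Theory.
Local Open Scope ring_scope.

(* Graphs on a finite vertex type are given by their adjacency relation. *)
Definition is_clique (T : finType) (e : rel T) (C : {set T}) : bool :=
  [forall x in C, forall y in C, (x != y) ==> e x y].

Definition clique_number (T : finType) (e : rel T) : nat :=
  \max_(C : {set T} | is_clique e C) #|C|.

Definition oppset (V : finZmodType) (A : {set V}) : {set V} :=
  [set - a | a in A].

Definition diffset (V : finZmodType) (A : {set V}) : {set V} :=
  [set a - b | a in A, b in A].

(* A simple graph when S = oppset S and 0 is not in S. *)
Definition Cay (V : finZmodType) (S : {set V}) : rel V :=
  fun x y => x - y \in S.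

Definition powers (F : finFieldType) (d : nat) : {set F} :=
  [set x ^+ d | x : F & x != 0].

(* The exponent i : 'Z_d is read as its representative in {0, ..., d - 1}
   (for 1 < d); the coset g ^+ i * H does not depend on this choice, because
   g ^+ d lies in H. *)
Definition coset_union (F : finFieldType) (d : nat) (g : F) (I : {set 'Z_d}) :
    {set F} :=
  \bigcup_(i in I) [set g ^+ (i : nat) * h | h in powers F d].

Definition GP (F : finFieldType) (d : nat) : rel F := Cay (powers F d).

(* Main.v *)
(* Let C be a clique, N = #|C|, and let T be the union of the cosets g^k H for k in
   I - I, so that the quotients (b - b') / (a - a') of differences of distinct
   elements of C lie in T.  For y outside of T and 0, the elements b - a y with
   a, b in C are therefore distinct, so that h(X, y) = prod_(a, b in C) (X - b + a y)
   divides X^q - X.  Dividing X^q - X by h as polynomials in X and y gives a multiple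
   h g of total degree at most q; the coefficient of X^j in X^q - X - h g has degree at
   most q - j in y and vanishes for the q - 1 - #|T| values of y above, hence it is
   zero for j >= #|T| + 2.  Setting y = 0 yields a polynomial X^q + g0(X) with
   deg g0 <= #|T| + 1 in which every element of C is a root of multiplicity at least
   N.  As q = p^(2r+1), extracting p-th roots and counting the roots of the
   derivative gives N <= p^r or N (N - p^r) <= #|T|. *)
Require Import Defs.
From mathcomp Require Import all_boot all_order all_algebra all_fingroup all_solvable.
From mathcomp Require Import all_field.
From mathcomp Require Import zify ring.

Set Implicit Arguments.
Unset Strict Implicit.
Unset Printing Implicit Defensive.

Import Order.TTheory GRing.Theory Num.Theory.
Local Open Scope ring_scope.

(** * Multiple roots and [p]-th roots of lacunary polynomials *)

Lemma card_mul_ltn_size (F : finFieldType) (C : {set F}) (k : nat) (f : {poly F}) :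
  f != 0 -> (forall c, c \in C -> ('X - c%:P) ^+ k %| f) ->
  (#|C| * k < size f)%N.
Proof.
move=> f_neq0 Cf.
have prod_dvd s : uniq s -> {subset s <= C} ->
    \prod_(c <- s) ('X - c%:P) ^+ k %| f.
  elim: s => [|c s IHs] /=; first by rewrite big_nil dvd1p.
  case/andP=> cNs s_uniq sC; rewrite big_cons Gauss_dvdp.
    rewrite Cf ?sC ?mem_head //= IHs // => x xs.
    by apply: sC; rewrite inE xs orbT.
  rewrite big_seq; apply: (big_rec (fun h => coprimep _ h)) => [|x h xs cop_h].
    exact: coprimep1.
  rewrite coprimepMr cop_h andbT; apply/coprimep_expl/coprimep_expr.
  by rewrite coprimep_XsubC2 // subr_eq0; apply: contraNneq cNs => <-.
have /(dvdp_leq f_neq0) : \prod_(c <- enum C) ('X - c%:P) ^+ k %| f.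
  by apply: prod_dvd (enum_uniq _) _ => x; rewrite mem_enum.
have := size_exp (\prod_(c <- enum C) ('X - c%:P)) k.
rewrite prodrXl size_prod_XsubC /= -cardE => <-.
apply: leq_trans; rewrite prednK // size_poly_gt0.
by rewrite expf_neq0 ?monic_neq0 ?monic_prod_XsubC.
Qed.

(** A vanishing derivative leaves only exponents divisible by [p], and the Frobenius map is additive
    and onto. *)
Lemma deriv0_expp (F : finFieldType) (p n : nat) (f : {poly F}) :
  prime p -> #|F| = (p ^ n)%N -> f^`() = 0 -> exists h, f = h ^+ p.
Proof.
move=> p_pr cardF df0; have charF := card_finPcharP cardF p_pr.
have n_gt0 : (0 < n)%N.
  by case: n cardF => // cardF; have := finNzRing_gt1 F; rewrite cardF.
have charP : p \in [pchar {poly F}] by rewrite pchar_poly.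
(* [c ^+ (p ^ n.-1)] is a [p]-th root of [c], because [c ^+ (p ^ n) = c]. *)
exists (\sum_(i < size f) (f`_(i * p) ^+ (p ^ n.-1))%:P * 'X^i).
rewrite -(pFrobenius_autE charP) rmorph_sum /=.
under eq_bigr => i _ do
  rewrite pFrobenius_autE exprMn -exprM -polyC_exp -exprM -expnSr prednK //
          -cardF expf_card.
apply/polyP => i; rewrite coef_sum.
have [/dvdnP[j ->]|pNi] := boolP (p %| i)%N.
  have [jp|jp] := ltnP (j * p) (size f).
    have j_lt : (j < size f)%N.
      by apply: leq_ltn_trans jp; rewrite leq_pmulr ?prime_gt0.
    rewrite (bigD1 (Ordinal j_lt)) //= coefCM coefXn eqxx mulr1 big1 ?addr0 //.
    move=> k kj; rewrite coefCM coefXn eqn_pmul2r ?prime_gt0 //.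
    by rewrite -val_eqE /= eq_sym in kj; rewrite (negPf kj) mulr0.
  rewrite nth_default // big1 // => k _; rewrite coefCM coefXn.
  case: eqP => [<-|]; last by rewrite mulr0.
  by rewrite nth_default // mul0r.
rewrite big1 => [|k _]; last first.
  rewrite coefCM coefXn; case: eqP => [ik|]; last by rewrite mulr0.
  by rewrite ik dvdn_mull in pNi.
case: i pNi => [|i] pNi; first by rewrite dvdn0 in pNi.
have /eqP := congr1 (fun g : {poly F} => g`_i) df0.
rewrite coef_deriv coef0 -mulr_natr mulf_eq0 -(dvdn_pcharf charF) (negPf pNi).
by rewrite orbF => /eqP.
Qed.

Lemma dvdp_exp_XsubC_deriv (F : fieldType) (f : {poly F}) (c : F) (k : nat) :
  ('X - c%:P) ^+ k %| f -> ('X - c%:P) ^+ k.-1 %| f^`().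
Proof.
case: k => [|k]; first by rewrite !expr0 !dvd1p.
case/dvdpP=> h ->; rewrite derivM deriv_exp derivXsubC mul1r /=.
apply: dvdp_add; first by rewrite exprS !dvdp_mull.
by rewrite -mulr_natr mulrA mulrAC dvdp_mull.
Qed.

(** The two inequalities make [m] the quotient [k / p] rounded up, and raising [f] to the power [p]
    multiplies the multiplicity of [c] by [p]. *)
Lemma dvdp_exp_XsubC_root (F : fieldType) (f : {poly F}) (c : F) (p m k : nat) :
  f != 0 -> ('X - c%:P) ^+ k %| f ^+ p -> (k <= p * m)%N ->
  (p * m < k + p)%N -> ('X - c%:P) ^+ m %| f.
Proof.
move=> f_neq0 kf km mk.
have mup_exp j : mup c (f ^+ j) = (j * mup c f)%N.
  elim: j => [|j IHj]; first by rewrite mupNroot // rootE hornerC oner_eq0.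
  by rewrite exprS mupM ?expf_neq0 // IHj mulSn.
by move: kf; rewrite -!mup_geq ?expf_neq0 // mup_exp; nia.
Qed.

(* If g' != 0, the multiplicities drop by at most one in the derivative, which is g'. *)
Lemma lacunary_roots_or_root (F : finFieldType) (p n e M : nat) (C : {set F})
    (g : {poly F}) :
  prime p -> #|F| = (p ^ n)%N ->
  (size g <= p ^ e.+1)%N ->
  (forall c, c \in C -> ('X - c%:P) ^+ M %| 'X^(p ^ e.+1) + g) ->
  (#|C| * M.-1 <= (size g).-2)%N \/
  exists h : {poly F}, [/\ (size h <= p ^ e)%N, ((size h).-1 * p = (size g).-1)%N
    & 'X^(p ^ e.+1) + g = ('X^(p ^ e) + h) ^+ p].
Proof.
move=> p_pr cardF g_q CM.
have charP : p \in [pchar {poly F}] by rewrite pchar_poly (card_finPcharP cardF).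
have p_gt1 := prime_gt1 p_pr.
have [dg0|dg_neq0] := eqVneq g^`() 0; last first.
  left; have g_neq0 : g != 0 by apply: contraNneq dg_neq0 => ->; rewrite deriv0.
  have := lt_size_deriv g_neq0; suff: (#|C| * M.-1 < size g^`())%N by lia.
  apply: card_mul_ltn_size => // c /CM /dvdp_exp_XsubC_deriv.
  by rewrite derivD derivXn expnS mulrnA (mulrn_pchar charP) mul0rn add0r.
right; have [h gh] := deriv0_expp p_pr cardF dg0; exists h.
have g_size : ((size h).-1 * p)%N = (size g).-1 by rewrite gh size_exp.
split=> //.
  have : (0 < p ^ e)%N by rewrite expn_gt0; lia.
  by move: g_q; rewrite expnSr; nia.
by rewrite gh -!(pFrobenius_autE charP) rmorphD /= !pFrobenius_autE -exprM expnSr.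
Qed.

(** Induction on [u], extracting one [p]-th root per step: the multiplicity [M] becomes [M / p]
    rounded up, the degree bound [s] becomes [s / p] rounded down. A step with non-zero derivative
    gives the second alternative. After [u + 1] extractions a polynomial of degree [p ^ t] vanishing
    on [C] is left, which gives the first. *)
Lemma lacunary_multiple_roots (F : finFieldType) (p n t u M s : nat)
    (C : {set F}) (g : {poly F}) :
  prime p -> #|F| = (p ^ n)%N -> (0 < M)%N ->
  (size g <= s.+1)%N -> (size g <= p ^ (t + u).+1)%N ->
  (forall c, c \in C -> ('X - c%:P) ^+ M %| 'X^(p ^ (t + u).+1) + g) ->
  (#|C| <= p ^ t)%N \/ (#|C| * (M - p ^ u) <= s.-1)%N.
Proof.
move=> p_pr cardF; have p_gt0 := prime_gt0 p_pr.
elim: u M s g => [|u IHu] M s g M_gt0 g_s g_q CM.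
all: have [le|[h [h_q h_size gh]]] := lacunary_roots_or_root p_pr cardF g_q CM.
- right; rewrite expn0 subn1; lia.
- left; rewrite addn0 in h_q gh.
  have fh_size : size ('X^(p ^ t) + h) = (p ^ t).+1.
    by rewrite size_polyDl size_polyXn.
  have fh_neq0 : 'X^(p ^ t) + h != 0 by rewrite -size_poly_gt0 fh_size.
  rewrite -ltnS -fh_size -(muln1 #|C|); apply: card_mul_ltn_size => // c cC.
  apply: (@dvdp_exp_XsubC_root _ _ _ p 1 1) => //; try lia.
  apply: dvdp_trans (dvdp_exp2l _ M_gt0) _; rewrite -gh.
  by have := CM c cC; rewrite addn0.
- right; apply: leq_trans (_ : #|C| * M.-1 <= _)%N; last by lia.
  by rewrite leq_mul2l -subn1 leq_sub2l ?orbT // expn_gt0 p_gt0.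
- rewrite addnS in h_q gh.
  have fh_neq0 : 'X^(p ^ (t + u).+1) + h != 0.
    by rewrite -size_poly_gt0 size_polyDl size_polyXn.
  pose m := ((M + p.-1) %/ p)%N.
  have /andP[M_le m_lt] : (M <= p * m < M + p)%N.
    have := divn_eq (M + p.-1) p; have := ltn_pmod (M + p.-1) p_gt0.
    rewrite -/m; nia.
  have [|||le|le] := IHu m (s %/ p)%N h _ _ h_q _; [nia| | |by left|right].
  + have : ((size h).-1 <= s %/ p)%N; last by lia.
    by rewrite leq_divRL // h_size; lia.
  + move=> c cC; apply: dvdp_exp_XsubC_root M_le m_lt => //.
    by rewrite -gh -addnS CM.
  (* Since [M <= p * m], the bound for [h] multiplied by [p] controls [#|C| * (M - P * p)]; rounding
     [s / p] down keeps the right side at most [s.-1]. *)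
  + have := leq_trunc_div s p; rewrite expnSr; move: (p ^ u)%N le => P le sp.
    have: (#|C| * (M - P * p) <= #|C| * (m - P) * p)%N.
      by rewrite -mulnA leq_mul2l mulnBl (mulnC m) leq_sub2r ?orbT.
    nia.
Qed.

(** * Total degree and division of bivariate polynomials *)

(* The total degree of f, viewed as a polynomial in two variables, is at most n:
   for n < j the truncated difference is 0, so that f`_j = 0. *)
Definition total_degree_le (R : nzRingType) (n : nat) (f : {poly {poly R}}) :=
  forall j, (size (f`_j)%R <= n.+1 - j)%N.

Lemma total_degree_leD (R : nzRingType) (n : nat) (f g : {poly {poly R}}) :
  total_degree_le n f -> total_degree_le n g -> total_degree_le n (f + g).
Proof.
move=> fn gn j; rewrite coefD.
by apply: leq_trans (size_polyD _ _) _; rewrite geq_max fn gn.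
Qed.

Lemma total_degree_leN (R : nzRingType) (n : nat) (f : {poly {poly R}}) :
  total_degree_le n f -> total_degree_le n (- f).
Proof. by move=> fn j; rewrite coefN size_polyN. Qed.

Lemma total_degree_leM (R : nzRingType) (m n : nat) (f g : {poly {poly R}}) :
  total_degree_le m f -> total_degree_le n g -> total_degree_le (m + n) (f * g).
Proof.
move=> fm gn j; rewrite coefM; apply: leq_trans (size_sum _ _ _) _.
apply/bigmax_leqP => -[i /= i_j] _.
have [->|f0] := eqVneq f`_i 0; first by rewrite mul0r size_poly0.
have [->|g0] := eqVneq g`_(j - i) 0; first by rewrite mulr0 size_poly0.
have := size_polyMleq f`_i g`_(j - i); have := fm i; have := gn (j - i)%N.
move: f0 g0; rewrite -!size_poly_gt0.
by move: (size _) (size _) (size _) => a b c; lia.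
Qed.

Lemma total_degree_leXsubC (R : nzRingType) (a : {poly R}) :
  (size a <= 2)%N -> total_degree_le 1 ('X - a%:P).
Proof.
move=> a2 j; rewrite coefB coefX coefC; case: j => [|[|j]] //=.
- by rewrite sub0r size_polyN.
- by rewrite subr0 size_poly1.
- by rewrite subr0 size_poly0.
Qed.

Lemma total_degree_leCXn (R : nzRingType) (a : {poly R}) (k n : nat) :
  (size a <= n.+1 - k)%N -> total_degree_le n (a%:P * 'X^k).
Proof.
move=> an j; rewrite coefCM coefXn.
by case: eqP => [->|_]; rewrite ?mulr1 // mulr0 size_poly0.
Qed.

(** Long division in the outer variable: the degree of the monic [h] equals its total degree bound
    [m], so cancelling the leading term of [f] takes a monomial [t] of total degree at most [n], and
    [f - h * t] keeps the bound of [f]. *)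
Lemma total_degree_le_edivp (R : nzRingType) (m n : nat) (h f : {poly {poly R}}) :
  h \is monic -> size h = m.+1 -> total_degree_le m h ->
  total_degree_le (m + n) f ->
  exists2 g, total_degree_le n g & (size (f - h * g)%R <= m)%N.
Proof.
move=> h_monic h_size hm.
have [k] := ubnP (size f); elim: k f => // k IHk f /ltnSE f_k fn.
have [f_m|m_f] := leqP (size f) m.
  exists 0; last by rewrite mulr0 subr0.
  by move=> j; rewrite coef0 size_poly0.
have f_gt0 : (0 < size f)%N by apply: leq_ltn_trans m_f.
pose t := (lead_coef f)%:P * 'X^((size f).-1 - m).
have t_n : total_degree_le n t.
  by apply: total_degree_leCXn; have := fn (size f).-1; rewrite -lead_coefE; lia.
have f_neq0 : f != 0 by rewrite -size_poly_gt0.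
have lf_neq0 : lead_coef f != 0 by rewrite lead_coef_eq0.
have t_size : size t = (size f - m)%N.
  by rewrite size_Mmonic ?monicXn ?polyC_eq0 // size_polyC lf_neq0 size_polyXn; lia.
have ht_size : size (h * t) = size f.
  rewrite size_monicM // -?size_poly_gt0 t_size ?subn_gt0 // h_size; lia.
have ht_lead : lead_coef (h * t) = lead_coef f.
  by rewrite lead_coef_monicM // lead_coef_Mmonic ?monicXn // lead_coefC.
have [||g gn g_size] := IHk (f - h * t).
- apply: leq_trans f_k; rewrite -[X in (_ < X)%N]prednK // ltnS.
  apply/leq_sizeP => j; rewrite leq_eqVlt => /orP[/eqP<-|j_gt].
    by rewrite coefB -lead_coefE -ht_lead lead_coefE ht_size subrr.
  by rewrite coefB !nth_default ?subrr ?ht_size // -(prednK f_gt0).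
- apply: total_degree_leD => //; apply: total_degree_leN.
  exact: total_degree_leM.
- exists (t + g); first exact: total_degree_leD.
  by rewrite mulrDr opprD addrA.
Qed.

(** * Slopes determined by the grid [C] x [C] *)

Lemma lacunary_multiple (F : finFieldType) (C E : {set F}) :
  0 \notin E -> E != set0 -> (#|C| * #|C| <= #|F|)%N ->
  (forall y, y \in E -> {in setX C C &, injective (fun u => u.1 - u.2 * y)}) ->
  exists2 g : {poly F}, (size g <= #|F|.+1 - #|E|)%N &
    forall c, c \in C -> ('X - c%:P) ^+ #|C| %| 'X^#|F| + g.
Proof.
move=> E0 En0 CF Cinj; set q := #|F|; set N := #|C|.
have E_gt0 : (0 < #|E|)%N by rewrite card_gt0.
have q_gt1 : (1 < q)%N := finNzRing_gt1 F.
have E_lt : (#|E| < q)%N.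
  by rewrite -[q]cardsT; apply/proper_card/properP; split; [exact: subsetT | exists 0].
pose s := [seq (a, b) | a <- enum C, b <- enum C].
have s_size : size s = (N * N)%N by rewrite size_allpairs -!cardE.
have s_mem u : (u \in s) = (u \in setX C C).
  case: u => a b; rewrite inE /= -(mem_enum C a) -(mem_enum C b).
  apply/allpairsP/andP => [[[a' b'] /= [aC bC [-> ->]]]|[aC bC]] //.
  by exists (a, b).
(* The outer variable is X; the inner ['X] stands for y, which [ev] below specialises. *)
pose h : {poly {poly F}} := \prod_(u <- s) ('X - (u.1%:P - u.2%:P * 'X)%:P).
have h_monic : h \is monic by exact: monic_prod_XsubC.
have h_size : size h = (N * N).+1 by rewrite size_prod_XsubC s_size.
have h_deg : total_degree_le (N * N) h.
  rewrite -s_size /h; elim: (s) => [|u r IHr].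
    by move=> j; rewrite big_nil coef1; case: j => [|j]; rewrite ?size_poly1 ?size_poly0.
  rewrite big_cons; apply: (@total_degree_leM _ 1) IHr; apply: total_degree_leXsubC.
  rewrite (leq_trans (size_polyD _ _)) // size_polyN geq_max.
  rewrite (leq_trans (size_polyC_leq1 _)) // (leq_trans (size_polyMleq _ _)) //.
  by rewrite size_polyX addn2 /= ltnS size_polyC_leq1.
pose f : {poly {poly F}} := 'X^q - 'X.
have f_deg : total_degree_le (N * N + (q - N * N)) f.
  rewrite subnKC //; apply: total_degree_leD; last apply: total_degree_leN.
    rewrite -[X in total_degree_le _ X]mul1r; apply: total_degree_leCXn.
    by rewrite size_poly1; lia.
  rewrite -['X]mul1r; apply: (@total_degree_leCXn _ _ 1).
  by rewrite size_poly1; lia.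
have [g g_deg r_size] := total_degree_le_edivp h_monic h_size h_deg f_deg.
pose ev y : {poly {poly F}} -> {poly F} := map_poly (horner_eval y).
have ev_h y : ev y h = \prod_(u <- s) ('X - (u.1 - u.2 * y)%:P).
  rewrite /ev rmorph_prod; apply: eq_bigr => u _.
  by rewrite rmorphB /= map_polyX map_polyC /= /horner_eval !hornerE.
have ev_f y : ev y f = 'X^q - 'X.
  by rewrite /ev rmorphB /= map_polyXn map_polyX.
have ev_hg y : y \in E -> ev y (h * g) = 'X^q - 'X.
  move=> yE; apply/eqP; rewrite eq_sym -subr_eq0 -(ev_f y) -[X in X == 0]rmorphB /=.
  set r := map_poly _ _.
  (* The specialised remainder [r] is divisible by [ev y h], whose size [N * N + 1] exceeds that of
     [r]; hence [r] is zero. *)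
  have h_dvd : ev y h %| r.
    rewrite /r rmorphB /= -!/(ev y _) dvdp_sub //; last first.
      by rewrite /ev rmorphM dvdp_mulr.
    rewrite ev_f ev_h -(big_map (fun u => u.1 - u.2 * y) xpredT (fun z => 'X - z%:P)).
    apply: uniq_roots_dvdp.
      by apply/allP => z _; rewrite rootE !hornerE expf_card subrr.
    rewrite uniq_rootsE map_inj_in_uniq ?allpairs_uniq ?enum_uniq //.
      by move=> [a b] [a' b'] _ _ /= [-> ->].
    by move=> u v; rewrite !s_mem; apply: (Cinj y yE).
  have [//|r_neq0] := eqVneq r 0; have := dvdp_leq r_neq0 h_dvd.
  rewrite ev_h size_prod_XsubC s_size ltnNge => /negP[].
  exact: leq_trans (size_poly _ _) r_size.
exists (ev 0 (h * g) - 'X^q).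
  apply/leq_sizeP => j j_ge.
  have hg_f : (h * g)`_j = f`_j.
    apply/eqP; rewrite -subr_eq0; apply: contraLR j_ge => d_neq0.
    have := max_poly_roots d_neq0 _ (enum_uniq E); rewrite -cardE => lt_d.
    rewrite -ltnNge; have /lt_d : all (root ((h * g)`_j - f`_j)) (enum E).
      apply/allP => y; rewrite mem_enum => yE.
      have /(congr1 (fun k : {poly F} => k`_j)) := ev_hg y yE.
      rewrite -(ev_f y) /ev !coef_map /= /horner_eval => hgy.
      by rewrite rootE hornerD hornerN hgy subrr.
    have : (size ((h * g)`_j - f`_j)%R <= q.+1 - j)%N.
      rewrite -coefB -[X in X.+1](subnKC CF); apply: total_degree_leD.
        exact: total_degree_leM.
      exact: total_degree_leN.
    move: (size _) => k; lia.
  rewrite coefB /ev coef_map /= hg_f /horner_eval coefB !coefXn coefX.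
  (* As [#|E| < q], the index [j] is at least 2, out of reach of the term -X of [f]. *)
  have /negPf-> : j != 1 by lia.
  by rewrite subr0 hornerMn hornerC subrr.
(* At y = 0 the pair (c, b) gives the factor X - c whatever [b] is, so the [#|C|] choices of [b]
   produce the multiplicity. *)
move=> c cC; rewrite addrCA subrr addr0 /ev rmorphM /= dvdp_mulr // -/(ev 0 h) ev_h.
rewrite big_allpairs (big_rem c) ?mem_enum //= dvdp_mulr //.
under eq_bigr => b _ do rewrite mulr0 subr0.
by rewrite big_const_seq count_predT -cardE iter_mulr_1.
Qed.

(** [T] contains every slope, other than 0 and infinity, of a line through two points of [C] x [C].
    For a non-zero [y] that is no such slope, (a, b) -> b - a y is injective on the grid. *)
Lemma card_quotients_of_differences (F : finFieldType) (p r : nat) (C T : {set F}) :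
  prime p -> #|F| = (p ^ (2 * r + 1))%N ->
  0 \notin T -> 0 |: T != [set: F] ->
  (forall a a' b b', a \in C -> a' \in C -> b \in C -> b' \in C ->
    a != a' -> b != b' -> (b - b') / (a - a') \in T) ->
  (#|C| * (#|C| - p ^ r) <= #|T|)%N.
Proof.
move=> p_pr cardF T0 T_proper CT.
pose E := ~: (0 |: T).
have cardE : (#|E| + #|T|.+1 = #|F|)%N by rewrite -(cardsC (0 |: T)) cardsU1 T0 addnC.
have E_neq0 : E != set0 by rewrite -setCT (inj_eq (@setC_inj F)).
have E0 : 0 \notin E by rewrite !inE eqxx.
have Cinj y : y \in E -> {in setX C C &, injective (fun u => u.1 - u.2 * y)}.
  rewrite !inE negb_or => /andP[y_neq0 yNT] [b a] [b' a'].
  rewrite !inE /= => /andP[bC aC] /andP[bC' aC'] eq_y.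
  have {}eq_y : b - b' = (a - a') * y.
    by rewrite -[b](subrK (a * y)) eq_y; ring.
  have [aa'|aa'] := eqVneq a a'.
    by move/eqP: eq_y; rewrite aa' subrr mul0r subr_eq0 => /eqP->.
  have aa'_neq0 : a - a' != 0 by rewrite subr_eq0.
  have bb' : b != b' by rewrite -subr_eq0 eq_y mulf_neq0.
  case/negP: yNT; have := CT _ _ _ _ aC aC' bC bC' aa' bb'.
  by rewrite eq_y mulrAC divff // mul1r.
have CF : (#|C| * #|C| <= #|F|)%N.
  have /set0Pn[y /Cinj y_inj] := E_neq0.
  by rewrite -cardsX -(card_in_imset y_inj) max_card.
have [g g_size gC] := lacunary_multiple E0 E_neq0 CF Cinj.
have [->|C_neq0] := eqVneq C set0; first by rewrite cards0.
have e2r : (2 * r + 1 = (r + r).+1)%N by lia.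
(* The choice t = u = r puts [p ^ r] in both alternatives; the first makes the truncated difference
   zero. The degree bound [#|T|.+1] is [#|F| - #|E|]. *)
have [||||le|le] := @lacunary_multiple_roots F p _ r r #|C| #|T|.+1 C g p_pr cardF.
- by rewrite card_gt0.
- by apply: leq_trans g_size _; rewrite -cardE -addnS addKn.
- apply: leq_trans g_size _; rewrite -e2r -cardF leq_subLR -add1n.
  by rewrite leq_add2r card_gt0.
- by rewrite -e2r -cardF.
- by move: le; rewrite -subn_eq0 => /eqP->; rewrite muln0.
- by [].
Qed.

(** * Cosets of the group of [d]-th powers *)

(** The [d]-th powers of non-zero elements are roots of X^k - 1 with k = ([#|F|] - 1) / d. *)
Lemma card_powers (F : finFieldType) (d : nat) :
  (d %| #|F|.-1)%N -> (d * #|powers F d| <= #|F|.-1)%N.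
Proof.
case/dvdnP=> k kd; have q_gt1 := finNzRing_gt1 F.
have : (0 < #|F|.-1)%N by rewrite -subn1 subn_gt0.
rewrite kd muln_gt0 => /andP[k_gt0 _].
have P_neq0 : 'X^k - 1 != 0 :> {poly F} by rewrite -size_poly_gt0 size_XnsubC.
have := max_poly_roots P_neq0 _ (enum_uniq (powers F d)).
rewrite size_XnsubC // -cardE mulnC => le_k.
rewrite leq_mul2r; apply/orP; right; rewrite -ltnS; apply: le_k.
apply/allP => y; rewrite mem_enum => /imsetP[x].
rewrite inE => x_neq0 ->; rewrite rootE !hornerE -exprM mulnC -kd.
suff -> : x ^+ #|F|.-1 = 1 by rewrite subrr.
by apply: (mulIf x_neq0); rewrite -exprSr prednK ?expf_card ?mul1r // ltnW.
Qed.

Lemma card_coset_union (F : finFieldType) (d : nat) (g : F) (I : {set 'Z_d}) :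
  (#|coset_union g I| <= #|I| * #|powers F d|)%N.
Proof.
rewrite -sum_nat_const /coset_union.
apply: (big_ind2 (fun (A : {set F}) n => #|A| <= n)%N) => [|A m B n Am Bn|i _].
- by rewrite cards0.
- by apply: leq_trans (leq_card_setU _ _) (leq_add Am Bn).
- exact: leq_imset_card.
Qed.

Lemma coset_union_diff_quotient (F : finFieldType) (d : nat) (g : F)
    (I : {set 'Z_d}) (x y : F) :
  (1 < d)%N -> g != 0 -> x \in coset_union g I -> y \in coset_union g I ->
  x / y \in coset_union g (diffset I).
Proof.
move=> d_gt1 g_neq0 /bigcupP[i iI /imsetP[_ /imsetP[u uP ->] ->]].
move=> /bigcupP[j jI /imsetP[_ /imsetP[v vP ->] ->]].
rewrite !inE in uP vP.
apply/bigcupP; exists (i - j); first by apply/imset2P; exists i j.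
(* Indices in ['Z_d] are added modulo [d], so on representatives a carry [e * d] appears; the factor
   [g ^+ (e * d)] is a [d]-th power and is absorbed in the coset. The modulus of ['Z_d] is literally
   [(Zp_trunc d).+2], equal to [d] as [1 < d]. *)
have [e ijE] : exists e, (j + (i - j)%R = i + e * d)%N.
  pose d' := (Zp_trunc d).+2.
  have ij : nat_of_ord (j + (i - j)) = ((j + (i - j)%R) %% d')%N by [].
  rewrite [j + (i - j)]addrC subrK in ij.
  exists ((j + (i - j)%R) %/ d')%N; rewrite [LHS](divn_eq _ d') -ij addnC.
  by congr (_ + _ * _)%N; apply: Zp_cast.
apply/imsetP; exists ((u / v / g ^+ e) ^+ d).
  by apply/imsetP; exists (u / v / g ^+ e); rewrite ?inE ?mulf_neq0 ?invr_neq0 ?expf_neq0.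
have : g ^+ j * g ^+ (i - j)%R = g ^+ i * g ^+ e ^+ d by rewrite -exprD ijE exprD exprM.
move/(canRL (mulKf (expf_neq0 _ g_neq0))) => ->.
rewrite !exprMn !exprVn.
field; rewrite ?expf_neq0 //.
Qed.

(** Equal powers of [g] have exponents congruent modulo [#|F| - 1], hence modulo [d]. Thus a proper
    index set yields a union of cosets that misses some non-zero element. *)
Lemma expg_mem_coset_union (F : finFieldType) (d : nat) (g : {unit F})
    (I : {set 'Z_d}) (j : 'Z_d) :
  (1 < d)%N -> (d %| #|F|.-1)%N -> generator [set: {unit F}] g ->
  (val g ^+ j \in coset_union (val g) I) -> j \in I.
Proof.
move=> d_gt1 d_dvd /eqP g_gen /bigcupP[i iI /imsetP[_ /imsetP[x x_neq0 ->]]].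
rewrite inE -unitfE in x_neq0.
have : FinRing.Unit x_neq0 \in <[g]>%g by rewrite -g_gen inE.
case/cycleP=> n /(congr1 val) /= ->.
rewrite FinRing.val_unitX -exprM -exprD -!FinRing.val_unitX.
move/val_inj/eqP; rewrite eq_expg_mod_order.
have -> : #[g]%g = #|F|.-1 by rewrite orderE -g_gen card_finField_unit.
move=> ji; suff -> : j = i by [].
have lt_d (k : 'Z_d) : (k < d)%N by rewrite -[X in (_ < X)%N](Zp_cast d_gt1) ltn_ord.
apply: val_inj; rewrite /= -(modn_small (lt_d j)) -(modn_small (lt_d i)).
by move/eqP: ji => /(congr1 (modn ^~ d)); rewrite !modn_dvdm // [(i + _)%N]addnC modnMDl.
Qed.

(** * The clique bound, over the integers and then with square roots *)

(** With truncated subtraction, a clique of N vertices satisfies (N - p^r)^2 <= N (N - p^r), and the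
    slope bound applies to the right side; for N <= p^r the left side is 0. *)
Lemma clique_number_Cay_coset_union (F : finFieldType) (d p r : nat)
    (g : {unit F}) (I : {set 'Z_d}) :
  (1 < d)%N -> prime p -> #|F| = (p ^ (2 * r + 1))%N -> (d %| #|F|.-1)%N ->
  generator [set: {unit F}] g -> diffset I != [set: 'Z_d] ->
  (d * (clique_number (Cay (coset_union (val g) I)) - p ^ r) ^ 2
     <= #|diffset I| * #|F|)%N.
Proof.
move=> d_gt1 p_pr cardF d_dvd g_gen I_proper.
have g_neq0 : val g != 0 by rewrite -unitfE (valP g).
pose T := coset_union (val g) (diffset I).
have T0 : 0 \notin T.
  apply/negP => /bigcupP[i _ /imsetP[_ /imsetP[x x_neq0 ->] /esym/eqP]].
  by rewrite inE in x_neq0; rewrite mulf_eq0 !expf_eq0 (negPf g_neq0) (negPf x_neq0) !andbF.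
have T_proper : 0 |: T != [set: F].
  apply: contraNneq I_proper => TE; apply/eqP/setP => j; rewrite inE.
  apply: expg_mem_coset_union d_gt1 d_dvd g_gen _.
  have : val g ^+ j \in 0 |: T by rewrite TE inE.
  by rewrite !inE expf_eq0 (negPf g_neq0) andbF.
rewrite /clique_number; apply: (big_ind (fun n => d * (n - p ^ r) ^ 2 <= _)%N).
- by rewrite sub0n muln0.
- by move=> m n; rewrite /maxn; case: ifP.
move=> C; rewrite /is_clique => /forall_inP C_clique.
have CS a b : a \in C -> b \in C -> a != b -> a - b \in coset_union (val g) I.
  by move=> aC bC ab; have /forall_inP/(_ b bC)/implyP/(_ ab) := C_clique a aC.
have CT : (#|C| * (#|C| - p ^ r) <= #|T|)%N.
  apply: card_quotients_of_differences p_pr cardF T0 T_proper _.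
  move=> a a' b b' aC a'C bC b'C aa' bb'.
  by apply: coset_union_diff_quotient; rewrite ?CS.
apply: leq_trans (_ : d * #|T| <= _)%N.
  by rewrite leq_mul2l orbC (leq_trans _ CT) // leq_mul2r leq_subr orbT.
apply: leq_trans (_ : d * (#|diffset I| * #|powers F d|) <= _)%N.
  by rewrite leq_mul2l card_coset_union orbT.
by rewrite mulnCA leq_mul2l (leq_trans (card_powers d_dvd)) ?leq_pred ?orbT.
Qed.

Lemma ler_sqrt_of_sqrn (R : rcfType) (d k m n q : nat) : (0 < d)%N ->
  (d * (n - m) ^ 2 <= k * q)%N ->
  n%:R <= Num.sqrt (k%:R * q%:R / d%:R) + m%:R :> R.
Proof.
move=> d_gt0 le_kq; have [nm|mn] := leqP n m.
  by apply: ler_wpDl; rewrite ?sqrtr_ge0 ?ler_nat.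
rewrite -lerBlDr -natrB 1?ltnW // -[X in X <= _]ger0_norm // -sqrtr_sqr ler_wsqrtr //.
by rewrite ler_pdivlMr ?ltr0n // -natrX -!natrM ler_nat mulnC.
Qed.

Lemma coset_union1 (F : finFieldType) (d : nat) (g : F) :
  coset_union g [set 0 : 'Z_d] = powers F d.
Proof.
rewrite /coset_union big_set1 expr0 -[RHS]imset_id.
by apply: eq_imset => x; rewrite mul1r.
Qed.

Theorem corollary1p3 (R : rcfType) (d p r q : nat)
    (d_ge2 : (2 <= d)%N) (p_prime : prime p)
    (q_odd_power : q = (p ^ (2 * r + 1))%N)
    (q_mod_d : q = 1 %[mod d])
    (F : finFieldType) (card_F : #|F| = q) :
  (forall (g : {unit F}) (I : {set 'Z_d}),
      generator [set: {unit F}] g ->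
      let S := coset_union (val g) I in
      S = oppset S ->
      diffset I != [set: 'Z_d] ->
      (clique_number (Cay S))%:R
        <= Num.sqrt (#|diffset I|%:R * q%:R / d%:R) + Num.sqrt (q%:R / p%:R) :> R)
  /\
  ((odd q -> q = 1 %[mod 2 * d]) ->
      (clique_number (@GP F d))%:R
        <= Num.sqrt (q%:R / d%:R) + Num.sqrt (q%:R / p%:R) :> R).
Proof.
have cardF : #|F| = (p ^ (2 * r + 1))%N by rewrite card_F.
have d_dvd : (d %| #|F|.-1)%N.
  have q_gt0 : (0 < q)%N by rewrite q_odd_power expn_gt0 prime_gt0.
  by rewrite card_F -subn1 -eqn_mod_dvd // q_mod_d.
have sqrt_qp : Num.sqrt (q%:R / p%:R) = (p ^ r)%:R :> R.
  rewrite q_odd_power addn1 expnS natrM mulrAC divff ?pnatr_eq0 -?lt0n ?prime_gt0 //.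
  by rewrite mul1r mulnC expnM natrX sqrtr_sqr ger0_norm.
have bound g I : generator [set: {unit F}] g -> diffset I != [set: 'Z_d] ->
    (clique_number (Cay (coset_union (val g) I)))%:R
      <= Num.sqrt (#|diffset I|%:R * q%:R / d%:R) + Num.sqrt (q%:R / p%:R) :> R.
  move=> g_gen I_proper; rewrite sqrt_qp; apply: ler_sqrt_of_sqrn; first exact: ltnW.
  by rewrite -card_F; apply: clique_number_Cay_coset_union.
split=> [g I g_gen S _|_]; first exact: bound.
(* The Paley graph is the case I = {0} for any primitive root; there I - I = {0}, which is proper
   because [d >= 2]. *)
have /cyclicP[g g_gen] := field_unit_group_cyclic [set: {unit F}].
have diff0 : diffset [set 0 : 'Z_d] = [set 0].
  by rewrite /diffset imset2_set1l imset_set1 subr0.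
have := @bound g [set 0]; rewrite coset_union1 diff0 cards1 mul1r; apply.
  by rewrite /generator g_gen.
by rewrite eqEcard cardsT card_ord cards1 andbF.
Qed.
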